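(* Let $G$ and $H$ be graphs such that $\chi_q(G)=\bar{\vartheta}(G)$ and $\chi_q(H)=\bar{\vartheta}(H)$. Then \[\chi_q(G\times H)=\min\{\chi_q(G),\chi_q(H)\}.\]
   Context: Graphs are finite, simple and undirected; no vertex is adjacent to itself. The categorical product $G\times H$ has vertex set $V(G)\times V(H)$, with $(u_1,v_1)\sim(u_2,v_2)$ iff $u_1\sim u_2$ and $v_1\sim v_2$. For a real $k>1$, a strict vector $k$-coloring of $G$ is a map $\varphi$ from $V(G)$ to the unit sphere of some $\mathbb{R}^d$ with $\varphi(u)^T\varphi(v)=-\frac1{k-1}$ whenever $u\sim v$; $\bar{\vartheta}(G)$ is the infimum of such $k$, equivalently the Lovász theta function of the complement of $G$. For a graph $H$ and integer $d\ge1$, the measurement graph $M(H,d)$ has as vertices all tuples $(E_v)_{v\in V(H)}$ of orthogonal projectors in $\mathbb{C}^{d\times d}$ summing to $I$; $(E_v)$ and $(E'_v)$ are adjacent iff $E_vE'_{v'}=0$ whenever $v\not\sim v'$ (including $v=v'$). The quantum chromatic number $\chi_q(G)$ is the least $n$ such that there is a graph homomorphism from $G$ to $M(K_n,d)$ for some $d$. *)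

(* Defs.v *)
(* with mathcomp-analysis reals (inf) and real-closed complex. *)
From HB Require Import structures.
From mathcomp Require Import all_boot all_order all_algebra.
From mathcomp Require Import boolp classical_sets reals.
From mathcomp Require Import complex.
Set Implicit Arguments. Unset Strict Implicit. Unset Printing Implicit Defensive.
Import Order.TTheory GRing.Theory Num.Theory.
Local Open Scope ring_scope.

(* A finite simple graph: vertex finType T with symmetric irreflexive edge rel. *)
Definition simple_graph (T : finType) (e : rel T) : Prop :=
  symmetric e /\ irreflexive e.

(* Categorical (tensor) product G x H. *)
Definition cat_prod (T U : finType) (eG : rel T) (eH : rel U) : rel (T * U) :=
  fun x y => eG x.1 y.1 && eH x.2 y.2.

(* Standard inner product on R^d, vectors as row vectors. *)
Definition dotv (R : realType) (d : nat) (u v : 'rV[R]_d) : R :=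
  \sum_(i < d) u ord0 i * v ord0 i.

(* Strict vector k-colouring of G in some R^d. *)
Definition strict_vector_coloring (R : realType) (T : finType) (e : rel T)
    (k : R) (d : nat) (phi : T -> 'rV[R]_d) : Prop :=
  (forall x, dotv (phi x) (phi x) = 1) /\
  (forall x y, e x y -> dotv (phi x) (phi y) = - (k - 1)^-1).

(* thetabar(G) = inf { k > 1 | G has a strict vector k-colouring }. *)
Definition thetabar (R : realType) (T : finType) (e : rel T) : R :=
  inf [set k : R | 1 < k /\
        exists (d : nat) (phi : T -> 'rV[R]_d), strict_vector_coloring e k phi].

(* Conjugate transpose of a complex matrix. *)
Definition adjmx (R : rcfType) (d : nat) (A : 'M[R[i]]_d) : 'M[R[i]]_d :=
  (map_mx (fun z : R[i] => z^*) A)^T.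

(* Orthogonal projector. *)
Definition is_projector (R : rcfType) (d : nat) (E : 'M[R[i]]_d) : Prop :=
  E *m E = E /\ adjmx E = E.

(* Vertices of the measurement graph M(H,d): tuples (E_v)_{v in V(H)} of
   orthogonal projectors in C^{d x d} summing to I. *)
Definition meas_vertex (R : rcfType) (V : finType) (d : nat)
    (E : V -> 'M[R[i]]_d) : Prop :=
  (forall v, is_projector (E v)) /\ \sum_(v : V) E v = 1%:M.

(* Adjacency in M(H,d): E_v E'_{v'} = 0 whenever v is not adjacent to v'
   in H (including v = v'). *)
Definition meas_adj (R : rcfType) (V : finType) (eH : rel V) (d : nat)
    (E E' : V -> 'M[R[i]]_d) : Prop :=
  forall v v', ~~ eH v v' -> E v *m E' v' = 0.

(* Complete graph K_n. *)
Definition complete_rel (n : nat) : rel 'I_n := fun i j => i != j.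

(* A graph homomorphism G -> M(H,d). *)
Definition hom_to_meas (R : rcfType) (T : finType) (e : rel T)
    (V : finType) (eH : rel V) (d : nat) (f : T -> V -> 'M[R[i]]_d) : Prop :=
  (forall x, meas_vertex (f x)) /\
  (forall x y, e x y -> meas_adj eH (f x) (f y)).

(* G admits a homomorphism to M(K_n, d) for some d >= 1. *)
Definition quantum_colorable (R : rcfType) (T : finType) (e : rel T) (n : nat) : Prop :=
  exists (d : nat), (0 < d)%N /\
    exists f : T -> 'I_n -> 'M[R[i]]_d, hom_to_meas e (@complete_rel n) f.

(* chi_q(G): the least such n (0 if none exists, which never happens for
   loopless graphs). *)
Definition chi_q (R : rcfType) (T : finType) (e : rel T) : nat :=
  match pselect (exists n : nat, `[< quantum_colorable R e n >]) with
  | left h => ex_minn h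
  | right _ => 0%N
  end.

(* Main.v *)
(* A quantum n-colouring of G x H gives, through the entries of the matrices
   E_c - I/n, a strict vector n-colouring of G x H, so it suffices to see that
   n cannot be smaller than both thetabar(G) and thetabar(H). If k < thetabar(G),
   semidefinite duality gives a weighted adjacency matrix A and a positive
   diagonal matrix D with -D <= A <= a D for the largest generalised eigenvalue
   a > k - 1; likewise (B, D', b) for H. With m = max(a, b) the matrix
   m D (x) D' + A (x) B is positive semidefinite and supported on the edges of
   G x H and the diagonal. Pairing it with the Gram matrix of the colouring,
   weighted by the two top eigenvectors, yields m (n - 1) >= a b, that is
   n - 1 >= min(a, b). *)
Require Import Defs.
From HB Require Import structures.
From mathcomp Require Import all_boot all_order all_algebra.
From mathcomp Require Import boolp classical_sets reals.
From mathcomp Require Import complex.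
From mathcomp Require Import ring lra.
Import Order.TTheory GRing.Theory Num.Theory.
Local Open Scope ring_scope.

(** * Positive semidefinite kernels and their rank-one decompositions *)

Section QuadraticForms.
Context {R : rcfType} {T : finType}.
Implicit Types (M N : T -> T -> R) (x y z w : T -> R).

Definition bform M x y : R := \sum_u \sum_v M u v * (x u * y v).

Definition psd M : Prop :=
  (forall u v, M u v = M v u) /\ (forall x, 0 <= bform M x x).

Lemma bform_addM M N x y :
  bform (fun u v => M u v + N u v) x y = bform M x y + bform N x y.
Proof.
rewrite /bform -big_split; apply: eq_bigr => u _ /=.
by rewrite -big_split; apply: eq_bigr => v _ /=; rewrite mulrDl.
Qed.

Lemma bform_scaleM c M x y : bform (fun u v => c * M u v) x y = c * bform M x y.
Proof.
rewrite /bform mulr_sumr; apply: eq_bigr => u _.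
by rewrite mulr_sumr; apply: eq_bigr => v _; rewrite -mulrA.
Qed.

Lemma bform_linl M x y z t :
  bform M (fun u => x u + t * y u) z = bform M x z + t * bform M y z.
Proof.
rewrite /bform mulr_sumr -big_split; apply: eq_bigr => u _ /=.
by rewrite mulr_sumr -big_split; apply: eq_bigr => v _ /=; ring.
Qed.

Lemma bform_linr M x y z t :
  bform M z (fun u => x u + t * y u) = bform M z x + t * bform M z y.
Proof.
rewrite /bform mulr_sumr -big_split; apply: eq_bigr => u _ /=.
by rewrite mulr_sumr -big_split; apply: eq_bigr => v _ /=; ring.
Qed.

Lemma bformC M x y : (forall u v, M u v = M v u) -> bform M x y = bform M y x.
Proof.
move=> symM; rewrite /bform exchange_big; apply: eq_bigr => u _ /=.
by apply: eq_bigr => v _; rewrite symM [x v * _]mulrC.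
Qed.

Lemma bform_eq M N x : (forall u v, M u v = N u v) -> bform M x x = bform N x x.
Proof. by move=> E; apply: eq_bigr => u _; apply: eq_bigr => v _; rewrite E. Qed.

Lemma bform_square M x y t : (forall u v, M u v = M v u) ->
  bform M (fun u => x u + t * y u) (fun u => x u + t * y u) =
  bform M x x + 2 * t * bform M x y + t ^+ 2 * bform M y y.
Proof.
by move=> symM; rewrite bform_linl !bform_linr (bformC _ y x symM); ring.
Qed.

Lemma bform_diag w x :
  bform (fun u v => if u == v then w u else 0) x x = \sum_u w u * x u ^+ 2.
Proof.
apply: eq_bigr => u _.
rewrite (bigD1 u) //= eqxx big1 ?addr0 ?expr2 // => v /negbTE vu.
by rewrite eq_sym vu mul0r.
Qed.

Lemma bform_rank1 f x :
  bform (fun u v => f u * f v) x x = (\sum_u f u * x u) ^+ 2.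
Proof.
rewrite expr2 mulr_suml; apply: eq_bigr => u _.
by rewrite mulr_sumr; apply: eq_bigr => v _; ring.
Qed.

Definition delta (s : T) : T -> R := fun u => (u == s)%:R.

Lemma sum_delta s (F : T -> R) : \sum_u F u * delta s u = F s.
Proof.
rewrite (bigD1 s) //= /delta eqxx mulr1 big1 ?addr0 // => v /negbTE ->.
by rewrite mulr0.
Qed.

Lemma bform_delta M x s : bform M x (delta s) = \sum_u M u s * x u.
Proof.
apply: eq_bigr => u _; rewrite -(sum_delta s (fun v => M u v * x u)).
by apply: eq_bigr => v _; rewrite mulrA.
Qed.

Lemma bform_delta2 M s : bform M (delta s) (delta s) = M s s.
Proof. by rewrite bform_delta (sum_delta s (fun u => M u s)). Qed.

Lemma psd_diag_ge0 M s : psd M -> 0 <= M s s.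
Proof. by case=> _ /(_ (delta s)); rewrite bform_delta2. Qed.

(** If [M u s] were nonzero, the form at [delta u + t * delta s] would be affine in [t] with nonzero
    slope, hence negative somewhere. *)
Lemma psd_diag0 M s u : psd M -> M s s = 0 -> M u s = 0.
Proof.
move=> psdM Mss; have [symM posM] := psdM.
apply/eqP/negPn/negP => Mus.
have q t : 0 <= M u u + 2 * t * M u s.
  have := posM (fun v => delta u v + t * delta s v).
  rewrite bform_square // !bform_delta2 Mss bform_delta.
  by rewrite (sum_delta u (fun v => M v s)) mulr0 addr0.
(* At this [t] the bound becomes [0 <= - M u u - 2]. *)
have := q (- (1 + M u u) / M u s).
rewrite -mulrA divfK //.
by have := psd_diag_ge0 _ u psdM; lra.
Qed.

(* One Schur complement step clears row and column [s]; when [M s s = 0] that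
   row already vanishes, and [x / 0 = 0] makes the formula still valid. *)
Lemma psd_schur M s : psd M ->
  psd (fun u v => M u v - M u s * M v s / M s s).
Proof.
move=> psdM; have [symM posM] := psdM; split=> [u v|x].
  by rewrite symM [M u s * _]mulrC.
have -> : bform (fun u v => M u v - M u s * M v s / M s s) x x =
   bform M x x - (bform M x (delta s)) ^+ 2 / M s s.
  rewrite bform_delta -bform_rank1 [X in _ = _ - X]mulrC -mulNr -bform_scaleM -bform_addM.
  by apply: bform_eq => u v; ring.
have [M0|M0] := eqVneq (M s s) 0; first by rewrite M0 invr0 mulr0 subr0.
have := posM (fun v => x v + - (bform M x (delta s) / M s s) * delta s v).
rewrite bform_square // bform_delta2; congr (_ <= _).
by field.
Qed.

(** Induction on the number of nonzero diagonal entries: a Schur step kills the pivot and creates no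
    new nonzero diagonal entry. The vector split off is the pivot column divided by the square root
    of the pivot. *)
Lemma psd_rank1_sum M : psd M ->
  exists fs : seq (T -> R), forall u v, M u v = \sum_(f <- fs) f u * f v.
Proof.
have [n] := ubnP #|[pred s | M s s != 0]|.
elim: n => // n IHn in M *; rewrite ltnS => leMn psdM; have [symM _] := psdM.
have [s Ms|M0] := pickP [pred s | M s s != 0]; last first.
  exists [::] => u v; rewrite big_nil; apply: psd_diag0 => //.
  by have := M0 v; rewrite /= => /negbFE/eqP.
have Ms0 : M s s != 0 by [].
have [|fs Hfs] := IHn _ _ (psd_schur _ s psdM).
  apply: leq_trans leMn; apply/proper_card/properP; split.
    apply/fintype.subsetP => u; rewrite !inE; apply: contra => /eqP Muu.
    have Mus : M u s = 0 by rewrite symM; apply: psd_diag0.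
    by rewrite Muu Mus !mul0r subr0.
  by exists s; rewrite !inE // mulfK // subrr eqxx.
exists ((fun u => M u s / Num.sqrt (M s s)) :: fs) => u v.
rewrite big_cons -Hfs mulrACA -invfM -expr2 sqr_sqrtr ?psd_diag_ge0 //.
by rewrite addrC subrK.
Qed.

(** Each term satisfies [|M u v * (x u * x v)| <= h * (x u ^+ 2 + x v ^+ 2) / 2], and these bounds
    add up to the correction term. It lets a small perturbation of a psd kernel be repaired by a
    multiple of the identity. *)
Lemma bform_diag_dominant M x (h : R) : (forall u v, `|M u v| <= h) ->
  0 <= bform M x x + h * #|T|%:R * \sum_u x u ^+ 2.
Proof.
move=> Mh.
have E : #|T|%:R * \sum_u x u ^+ 2 = \sum_u \sum_v (x u ^+ 2 + x v ^+ 2) / 2 :> R.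
  under [RHS]eq_bigr => u _ do rewrite -mulr_suml big_split /= sumr_const.
  rewrite -mulr_suml big_split /= sumr_const sumrMnl -mulr_natl.
  by field.
rewrite -mulrA E mulr_sumr -big_split /=; apply: sumr_ge0 => u _.
rewrite mulr_sumr -big_split /=; apply: sumr_ge0 => v _.
have := Mh u v; rewrite ler_norml => /andP[h1 h2].
have s1 := sqr_ge0 (x u + x v); have s2 := sqr_ge0 (x u - x v).
have d1 : 0 <= h - M u v by lra.
have d2 : 0 <= h + M u v by lra.
have -> : M u v * (x u * x v) + h * ((x u ^+ 2 + x v ^+ 2) / 2) =
   ((h + M u v) * (x u + x v) ^+ 2 + (h - M u v) * (x u - x v) ^+ 2) / 4 by field.
by rewrite divr_ge0 // addr_ge0 // mulr_ge0.
Qed.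

End QuadraticForms.

Lemma sum_pair (R : nmodType) (T U : finType) (F : T * U -> R) :
  \sum_p F p = \sum_u \sum_v F (u, v).
Proof. by rewrite pair_bigA; apply: eq_bigr => -[]. Qed.

(** Expanding [X] into rank-one terms turns the form at [z] into a sum of forms of [Y], each at [z]
    contracted with one factor [f] along [T]. *)
Lemma psd_tensor (R : rcfType) (T U : finType) (X : T -> T -> R) (Y : U -> U -> R) :
  psd X -> psd Y -> psd (fun p q : T * U => X p.1 q.1 * Y p.2 q.2).
Proof.
move=> /psd_rank1_sum[fs Xfs] [symY posY]; split=> [p q|z].
  by rewrite symY !Xfs; congr (_ * _); apply: eq_bigr => f _; rewrite mulrC.
have -> : bform (fun p q => X p.1 q.1 * Y p.2 q.2) z z =
    \sum_(f <- fs) bform Y (fun v => \sum_u f u * z (u, v)) (fun v => \sum_u f u * z (u, v)).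
  rewrite /bform.
  under eq_bigr => p _ do under eq_bigr => q _ do rewrite Xfs -mulrA mulr_suml.
  under eq_bigr => p _ do rewrite exchange_big /=.
  rewrite exchange_big /=; apply: eq_bigr => f _.
  rewrite sum_pair exchange_big /=; apply: eq_bigr => v _.
  under eq_bigr => u _ do rewrite sum_pair exchange_big /=.
  rewrite exchange_big /=; apply: eq_bigr => v' _.
  rewrite mulr_suml mulr_sumr; apply: eq_bigr => u _.
  by rewrite !mulr_sumr; apply: eq_bigr => u' _; ring.
by rewrite big_seq sumr_ge0.
Qed.

(** * A theorem of the alternative for the psd cone *)

Section Alternative.
Context {R : realType} {T : finType}.
Implicit Types (M N : T -> T -> R) (x w : T -> R).

Definition entry_prod M N : R := \sum_(p : T * T) M p.1 p.2 * N p.1 p.2.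

Definition masked (S : rel T) M : T -> T -> R := fun u v => if S u v then M u v else 0.

Lemma masked_prod_le S N : entry_prod (masked S N) (masked S N) <= entry_prod N N.
Proof.
apply: ler_sum => p _; rewrite /masked; case: ifP => // _.
by rewrite mul0r -expr2 sqr_ge0.
Qed.

Lemma entry_prod_rank1 N x : entry_prod N (fun u v => x u * x v) = bform N x x.
Proof. exact: sum_pair. Qed.

Lemma entry_prod_rank1_norm x :
  entry_prod (fun u v => x u * x v) (fun u v => x u * x v) = (\sum_u x u ^+ 2) ^+ 2.
Proof.
by rewrite entry_prod_rank1 bform_rank1.
Qed.

Lemma entry_prod_step S (b : T -> T -> R) M N t :
  let r M := masked S (fun u v => M u v - b u v) in
  entry_prod (r (fun u v => M u v + t * N u v)) (r (fun u v => M u v + t * N u v)) =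
  entry_prod (r M) (r M) + 2 * t * entry_prod (r M) N
    + t ^+ 2 * entry_prod (masked S N) (masked S N).
Proof.
rewrite /entry_prod !mulr_sumr -!big_split; apply: eq_bigr => p _ /=.
by rewrite /masked; case: ifP => _; ring.
Qed.

(* Let [r] be the residual [M - b] on [S] of an approximate minimiser [M] of the
   squared distance from the psd cone to [b]. Moving from [M] along a rank-one
   kernel or along [- M] cannot decrease the distance by much, so [r] is almost
   psd and almost orthogonal to [M]; adding a small multiple of the identity
   gives [X]. Approximate minimality replaces any compactness argument. *)
Lemma psd_alternative (S : rel T) (b : T -> T -> R) :
  symmetric S -> reflexive S -> (forall u v, b u v = b v u) ->
  (forall h, 0 < h -> exists M, psd M /\ forall u v, S u v -> `|M u v - b u v| <= h) \/
  (exists X, [/\ psd X, forall u, 0 < X u u, forall u v, ~~ S u v -> X u v = 0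
     & entry_prod X b < 0]).
Proof.
move=> symS reflS symb.
pose r M := masked S (fun u v => M u v - b u v).
pose dist M := entry_prod (r M) (r M).
have dist_ge0 M : 0 <= dist M by apply: sumr_ge0 => p _; rewrite -expr2 sqr_ge0.
pose E := [set x : R | exists2 M, psd M & x = dist M]%classic.
have psd0 : psd (fun _ _ : T => 0 : R).
  by split=> // x; rewrite /bform big1 // => u _; rewrite big1 // => v _; rewrite mul0r.
have E0 : (E !=set0)%classic by exists (dist (fun _ _ => 0)); exists (fun _ _ => 0).
have lbE : has_lbound E by exists 0 => _ [M _ ->].
have infE : has_inf E by [].
set c := inf E.
have c_le M : psd M -> c <= dist M by move=> pM; apply: ge_inf => //; exists M.
have near t : 0 < t -> exists2 M, psd M & dist M < c + t.
  by move=> /(inf_adherent)/(_ infE)[_ [M pM ->] ltM]; exists M.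
have c_ge0 : 0 <= c by apply: lb_le_inf => // _ [M _ ->].
have [c0|c_neq0] := eqVneq c 0.
  left=> h h0; have [|M pM ltM] := near (h ^+ 2); first by rewrite exprn_gt0.
  exists M; split=> // u v Suv; rewrite -(@ler_pXn2r _ 2) ?nnegrE ?(ltW h0) ?normr_ge0 //.
  rewrite real_normK ?num_real //.
  rewrite c0 add0r in ltM; apply: le_trans (ltW ltM).
  rewrite /dist /entry_prod (bigD1 (u, v)) //= {1 2}/r /masked Suv -expr2 lerDl.
  by apply: sumr_ge0 => p _; rewrite -expr2 sqr_ge0.
right.
have c_gt0 : 0 < c by rewrite lt_neqAle eq_sym c_neq0.
pose B := entry_prod (masked S b) (masked S b).
have B0 : 0 <= B by apply: sumr_ge0 => p _; rewrite -expr2 sqr_ge0.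
(* [K] bounds the squared norm of [M] on [S], through [M ^+ 2 <= 2 * (M - b) ^+ 2 + 2 * b ^+ 2] and
   [dist M <= c + 1]. *)
pose K := 2 * (c + 1) + 2 * B.
pose n := \sum_u `|b u u|.
have n0 : 0 <= n by apply: sumr_ge0.
(* With [d = c / L] this reads [c = d * (1 + K) + 4 * d * n + d * c], so the error terms below stay
   under [c]; it also gives [d <= 1]. *)
pose L := 1 + K + 4 * n + c.
have L0 : 0 < L by rewrite /L /K; lra.
pose d := c / L.
have d0 : 0 < d by rewrite divr_gt0.
have d1 : d <= 1 by rewrite ler_pdivrMr // mul1r /L /K; lra.
have dL : d * L = c by rewrite divfK // gt_eqF.
have [|M pM ltM] := near (d ^+ 2); first by rewrite exprn_gt0.
have [symM posM] := pM.
have symr u v : r M u v = r M v u by rewrite /r /masked symS symM symb.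
have prodM : 2 * entry_prod (r M) M <= d * (1 + K).
  (* Shrinking [M] by the factor [1 - d] stays in the cone, so the squared distance cannot drop
     below [c], while [dist M < c + d ^+ 2]. *)
  have pM' : psd (fun u v => M u v + (- d) * M u v).
    split=> [u v|x]; first by rewrite symM.
    rewrite bform_addM bform_scaleM -[X in X + _]mul1r -mulrDl.
    by rewrite mulr_ge0 // subr_ge0.
  have nM : entry_prod (masked S M) (masked S M) <= K.
    apply: (@le_trans _ _ (2 * dist M + 2 * B)).
      rewrite /dist /B /entry_prod !mulr_sumr -big_split; apply: ler_sum => p _.
      rewrite /r /masked; case: ifP => _ /=; last by rewrite !mul0r !mulr0 addr0.
      by have := sqr_ge0 (M p.1 p.2 - 2 * b p.1 p.2); rewrite !expr2; lra.
    have : d ^+ 2 <= 1 by rewrite exprn_ile1 // ltW.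
    by rewrite /K; lra.
  have := c_le _ pM'; rewrite /dist entry_prod_step -/(r M) -/(dist M) sqrrN => h.
  rewrite -(ler_pM2l d0).
  have := ler_wpM2l (sqr_ge0 d) nM.
  by rewrite !expr2 in h ltM *; lra.
have formr x : - d * \sum_u x u ^+ 2 <= bform (r M) x x.
  set s := \sum_u x u ^+ 2.
  have s_ge0 : 0 <= s by apply: sumr_ge0 => u _; apply: sqr_ge0.
  have [s0|s_neq0] := eqVneq s 0.
    rewrite s0 mulr0 /bform big1 // => u _; rewrite big1 // => v _.
    have -> : x u = 0; last by rewrite mul0r mulr0.
    apply/eqP; rewrite -sqrf_eq0; apply/eqP/(psumr_eq0P _ s0) => // i _.
    exact: sqr_ge0.
  have s_gt0 : 0 < s by rewrite lt_neqAle eq_sym s_neq0.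
  (* This makes the rank-one move have norm [d], the scale at which the first-order gain balances
     the slack [d ^+ 2] of [M]. *)
  pose t := d / s.
  have t0 : 0 < t by rewrite divr_gt0.
  have pM' : psd (fun u v => M u v + t * (x u * x v)).
    split=> [u v|y]; first by rewrite symM [x u * _]mulrC.
    by rewrite bform_addM bform_scaleM bform_rank1 addr_ge0 // mulr_ge0 ?sqr_ge0 // ltW.
  have := c_le _ pM'; rewrite /dist (entry_prod_step S b M (fun u v => x u * x v)).
  rewrite -/(r M) -/(dist M) entry_prod_rank1 => h.
  have := masked_prod_le S (fun u v => x u * x v).
  rewrite entry_prod_rank1_norm -/s => /(ler_wpM2l (sqr_ge0 t)).
  have -> : t ^+ 2 * s ^+ 2 = d ^+ 2 by rewrite -exprMn /t divfK.
  move=> h2; rewrite -(ler_pM2l t0).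
  have -> : t * (- d * s) = - d ^+ 2 by rewrite /t; field.
  by lra.
pose X u v := r M u v + (if u == v then 2 * d else 0).
have formX x : bform X x x = bform (r M) x x + 2 * d * \sum_u x u ^+ 2.
  by rewrite bform_addM bform_diag mulr_sumr.
exists X; split.
- split=> [u v|x]; first by rewrite /X symr eq_sym.
  rewrite formX; have := formr x.
  have s0 : 0 <= \sum_u x u ^+ 2 by apply: sumr_ge0 => u _; apply: sqr_ge0.
  have : 0 <= d * \sum_u x u ^+ 2 by rewrite mulr_ge0 // ltW.
  by lra.
- move=> u; rewrite -bform_delta2 formX; have := formr (delta u).
  have -> : \sum_v delta u v ^+ 2 = 1 :> R.
    by rewrite (sum_delta u (delta u)) /delta eqxx.
  by lra.
- move=> u v; rewrite /X /r /masked => nS; rewrite (negbTE nS) add0r.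
  by case: eqP nS => // ->; rewrite reflS.
(* On [S] one has [b = M - r M]. The first term is at most [d * (1 + K) / 2], the last at most
   [2 * d * n], and [dist M >= c]; by the choice of [L] the total is at most
   [(c - d * c) / 2 - c < 0]. *)
- have -> : entry_prod X b = entry_prod (r M) M - dist M + 2 * d * \sum_u b u u.
    rewrite /dist /entry_prod -sumrB mulr_sumr.
    have -> : \sum_u 2 * d * b u u =
        \sum_(p : T * T) (if p.1 == p.2 then 2 * d else 0) * b p.1 p.2.
      rewrite sum_pair; apply: eq_bigr => u _.
      rewrite (bigD1 u) //= eqxx big1 ?addr0 // => v /negbTE vu.
      by rewrite eq_sym vu mul0r.
    rewrite -big_split; apply: eq_bigr => p _ /=.
    by rewrite /X /r /masked; case: (S _ _); case: (_ == _); ring.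
  have := c_le _ pM.
  have : 2 * d * \sum_u b u u <= 2 * d * n.
    have d2 : 0 < 2 * d by lra.
    rewrite ler_pM2l //.
    by apply: ler_sum => u _; exact: ler_norm.
  have : d * L = d * (1 + K) + 4 * (d * n) + d * c by rewrite /L; ring.
  have : 0 < d * c by rewrite mulr_gt0.
  have : 0 <= d * n by rewrite mulr_ge0 // ltW.
  by lra.
Qed.
End Alternative.

(** * Vector colourings and dual certificates for [thetabar] *)

(** The rank-one factors of [M] serve as coordinates, so [M] is the Gram kernel of the colouring. *)
Lemma strict_vector_coloring_psd (R : realType) (T : finType) (e : rel T) (k : R)
    (M : T -> T -> R) :
  psd M -> (forall u, M u u = 1) -> (forall u v, e u v -> M u v = - (k - 1)^-1) ->
  exists (d : nat) (phi : T -> 'rV[R]_d), strict_vector_coloring e k phi.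
Proof.
move=> /psd_rank1_sum[fs Mfs] M1 Me.
exists (size fs), (fun u => \row_i nth (fun=> 0) fs i u).
have dotM u v : dotv (\row_(i < size fs) nth (fun=> 0) fs i u)
      (\row_i nth (fun=> 0) fs i v) = M u v.
  rewrite /dotv Mfs [RHS](big_nth (fun=> 0)) big_mkord; apply: eq_bigr => i _.
  by rewrite !mxE.
by split=> [u|u v]; rewrite dotM //; apply: Me.
Qed.

Lemma thetabar_le (R : realType) (T : finType) (e : rel T) (k : R) (d : nat)
    (phi : T -> 'rV[R]_d) :
  1 < k -> strict_vector_coloring e k phi -> thetabar R e <= k.
Proof.
move=> k1 col; apply: ge_inf; first by exists 1 => x [/ltW].
by split=> //; exists d, phi.
Qed.

Section Certificate.
Context {R : realType} {T : finType} (e : rel T).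
Hypothesis graph_e : simple_graph e.

Definition diagonal (w : T -> R) : T -> T -> R := fun u v => if u == v then w u else 0.

(** The alternative is applied to the Gram entries prescribed by a strict vector [k]-colouring, on
    the diagonal and the edges. Approximate solvability would give a colouring with parameter below
    [thetabar]; the other branch gives [X], and its negative pairing with [b] rearranges to the last
    inequality. *)
Lemma thetabar_dual (k : R) : 1 < k -> k < thetabar R e ->
  exists X : T -> T -> R, [/\ psd X, forall u, 0 < X u u,
    forall u v, u != v -> ~~ e u v -> X u v = 0
    & k * \sum_u X u u < \sum_(p : T * T) X p.1 p.2].
Proof.
move=> k1 kt; have [syme irre] := graph_e.
pose S u v := (u == v) || e u v.
pose b (u v : T) : R := if u == v then 1 else - (k - 1)^-1.
have k0 : 0 < k - 1 by lra.
have i0 : 0 < (k - 1)^-1 by rewrite invr_gt0.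
have symS : symmetric S by move=> u v; rewrite /S eq_sym syme.
have [||approx|[X [pX posX suppX Xb]]] := psd_alternative S b symS.
- by move=> u; rewrite /S eqxx.
- by move=> u v; rewrite /b eq_sym.
- (* Correcting the approximate solution costs a small multiple [l] of the
     identity, i.e. a slightly larger [k], still below [thetabar]. *)
  exfalso.
  (* The extra [1] keeps [n] positive for empty [T]; the total perturbation [l / n * #|T|] stays at
     most [l]. *)
  pose n : R := #|T|%:R + 1.
  have n0 : 0 < n by rewrite /n ltr_wpDl.
  (* Chosen so that [k'] below is the midpoint of [k] and [thetabar R e]. *)
  pose l := (thetabar R e - k) / (2 * (k - 1)).
  have l0 : 0 < l by rewrite divr_gt0 ?subr_gt0 // mulr_gt0.
  have [|M [pM Mb]] := approx (l / n); first by rewrite divr_gt0.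
  have [symM posM] := pM.
  (* Subtracting the error makes [M] equal to [b] on [S], adding [l] on the diagonal restores
     positivity, and dividing by [1 + l] restores unit norms. Edge entries become
     [- (k' - 1)^-1]. *)
  pose N u v := (1 + l)^-1 *
    (M u v + (- masked S (fun u v => M u v - b u v) u v + diagonal (fun=> l) u v)).
  have l1 : 0 < 1 + l by lra.
  have pN : psd N.
    split=> [u v|x].
      by rewrite /N symM /masked symS symM /b eq_sym /diagonal eq_sym.
    rewrite bform_scaleM !bform_addM mulr_ge0 ?invr_ge0 ?(ltW l1) // addr_ge0 //.
    rewrite bform_diag -mulr_sumr.
    have : 0 <= bform (fun u v => - masked S (fun u v => M u v - b u v) u v) x x +
        l / n * #|T|%:R * \sum_u x u ^+ 2.
      apply: bform_diag_dominant => u v; rewrite normrN /masked.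
      case: ifP => [/Mb //|_]; rewrite normr0 divr_ge0 // ltW //.
    move=> /le_trans; apply; rewrite lerD2l; apply: ler_wpM2r.
      by apply: sumr_ge0 => u _; apply: sqr_ge0.
    by rewrite mulrAC ler_pdivrMr // ler_wpM2l ?(ltW l0) // /n lerDl.
  pose k' := 1 + (k - 1) * (1 + l).
  have kl : 0 < (k - 1) * (1 + l) by rewrite mulr_gt0.
  have [|u v euv|d [phi col]] := strict_vector_coloring_psd R T e k' N pN.
  + move=> u; rewrite /N /masked /diagonal /S /b eqxx /=; field.
    by rewrite gt_eqF.
  + have uv : u == v = false by apply: contraTF euv => /eqP ->; rewrite irre.
    rewrite /N /masked /diagonal /S /b uv euv /=.
    have -> : k' - 1 = (k - 1) * (1 + l) by rewrite /k'; ring.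
    by rewrite invfM; ring.
  have k'1 : 1 < k' by rewrite /k'; lra.
  have := thetabar_le R T e k' d phi k'1 col.
  have : (k - 1) * l = (thetabar R e - k) / 2 by rewrite /l; field; rewrite gt_eqF.
  by rewrite /k' mulrDr; lra.
exists X; split=> // [u v uv nuv|].
  by apply: suppX; rewrite /S negb_or uv.
have E : entry_prod X b = (1 + (k - 1)^-1) * \sum_u X u u
     - (k - 1)^-1 * \sum_(p : T * T) X p.1 p.2.
  have -> : \sum_u X u u = \sum_(p : T * T) (if p.1 == p.2 then X p.1 p.2 else 0).
    rewrite sum_pair; apply: eq_bigr => u _.
    rewrite (bigD1 u) //= eqxx big1 ?addr0 // => v /negbTE vu.
    by rewrite eq_sym vu.
  rewrite /entry_prod !mulr_sumr -sumrB; apply: eq_bigr => p _.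
  by rewrite /b; case: ifP => _; ring.
rewrite -(ltr_pM2l i0) -subr_lt0; congr (_ < 0) : Xb; rewrite E; field.
by rewrite gt_eqF.
Qed.

(* [a] is the supremum of the Rayleigh quotients [x^T A x / x^T D x]; evaluating
   at the all-ones vector gives [a > k - 1]. *)
Lemma thetabar_certificate (k : R) : 1 < k -> k < thetabar R e ->
  exists (w : T -> R) (A : T -> T -> R) (a : R),
    [/\ forall u, 0 < w u, forall u v, ~~ e u v -> A u v = 0,
      psd (fun u v => diagonal w u v + A u v)
      & psd (fun u v => a * diagonal w u v + (- 1) * A u v)] /\ k - 1 < a /\
    forall s, s < a -> exists x, 0 < bform (diagonal w) x x /\
      s * bform (diagonal w) x x <= bform A x x.
Proof.
move=> k1 /(thetabar_dual k k1)[X [pX posX suppX ltX]]; have [syme irre] := graph_e.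
have [symX _] := pX.
(* [w] and [A] are the diagonal and off-diagonal parts of [X]. *)
pose w u := X u u.
have w0 u : 0 < w u by exact: posX.
pose A u v := if u == v then 0 else X u v.
pose W x := bform (diagonal w) x x.
have WE x : W x = \sum_u w u * x u ^+ 2 by exact: bform_diag.
have XE u v : diagonal w u v + A u v = X u v.
  rewrite /diagonal /A /w; have [->|_] := eqVneq u v; first exact: addr0.
  exact: add0r.
have W_ge0 x : 0 <= W x.
  by rewrite WE sumr_ge0 // => u _; rewrite mulr_ge0 ?sqr_ge0 ?(ltW (w0 u)).
pose h := \sum_(p : T * T) `|A p.1 p.2|.
pose g := \sum_u (w u)^-1.
have h0 : 0 <= h by apply: sumr_ge0.
(* A crude bound: it makes the Rayleigh quotients bounded above and settles the vectors with
   [W x = 0]. *)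
have A_le x : bform A x x <= h * #|T|%:R * g * W x.
  have : 0 <= bform (fun u v => -1 * A u v) x x + h * #|T|%:R * \sum_u x u ^+ 2.
    apply: bform_diag_dominant => u v; rewrite mulN1r normrN.
    by rewrite /h (bigD1 (u, v)) //= lerDl sumr_ge0.
  rewrite bform_scaleM mulN1r addrC subr_ge0 => /le_trans; apply.
  rewrite -[leRHS]mulrA ler_wpM2l ?mulr_ge0 // WE mulr_sumr; apply: ler_sum => u _.
  rewrite mulrA ler_peMl ?sqr_ge0 // -(mulVf (lt0r_neq0 (w0 u))).
  rewrite ler_pM2r ?w0 // /g (bigD1 u) //= lerDl sumr_ge0 // => v _.
  by rewrite invr_ge0 (ltW (w0 v)).
pose E := [set q : R | exists2 x, 0 < W x & q * W x = bform A x x]%classic.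
have W1 : W (fun=> 1) = \sum_u X u u.
  by rewrite WE; apply: eq_bigr => u _; rewrite expr1n mulr1.
have sumE : bform A (fun=> 1) (fun=> 1) = \sum_(p : T * T) X p.1 p.2 - \sum_u X u u.
  apply/eqP; rewrite eq_sym subr_eq -W1 -bform_addM; apply/eqP.
  by rewrite sum_pair; apply: eq_bigr => u _; apply: eq_bigr => v _; rewrite addrC XE !mulr1.
(* The strict inequality on [X] rules out an empty [T], where both of its sides would vanish. *)
have W1_gt0 : 0 < W (fun=> 1).
  rewrite lt_neqAle W_ge0 andbT; apply/eqP => W0.
  move: ltX; rewrite -W1 -W0 mulr0 => ltX.
  have : exists u : T, true.
    apply/existsP; apply: contraTT ltX => /existsPn noT.
    by rewrite big1 ?ltxx // => -[u v]; have := noT u.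
  move=> [u _]; have := W0; rewrite W1 => /esym.
  move=> /(psumr_eq0P (fun i _ => ltW (posX i)))/(_ u isT) Xu.
  by have := posX u; rewrite Xu ltxx.
have E1 : E (bform A (fun=> 1) (fun=> 1) / W (fun=> 1)).
  by exists (fun=> 1) => //; rewrite divfK // gt_eqF.
have ubE : has_ubound E.
  exists (h * #|T|%:R * g) => q [x Wx qW].
  by rewrite -(ler_pM2r Wx) qW.
have supE : has_sup E by split=> //; eexists; exact: E1.
exists w, A, (sup E); split; first split.
- exact: posX.
- by move=> u v nuv; rewrite /A; case: eqP => // /eqP uv; apply: suppX.
- split=> [u v|x]; first by rewrite !XE.
  by rewrite (bform_eq _ X) //; case: pX.
- split=> [u v|x].
    rewrite /diagonal /A symX [v == u]eq_sym; case: eqP => // ->; ring.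
  rewrite bform_addM !bform_scaleM mulN1r subr_ge0.
  have := W_ge0 x; rewrite le_eqVlt => /orP[/eqP Wx|Wx].
    by rewrite -/(W x) -Wx mulr0; have := A_le x; rewrite -Wx mulr0.
  rewrite -ler_pdivrMr //; apply: ub_le_sup => //.
  by exists x => //; rewrite divfK // gt_eqF.
split.
  apply: lt_le_trans (ub_le_sup ubE E1).
  by rewrite ltr_pdivlMr // sumE W1; lra.
move=> s ltsE; have [|q [x Wx qW] ltq] := sup_adherent (_ : 0 < sup E - s) supE.
  by rewrite subr_gt0.
exists x; split=> //; rewrite -qW ler_pM2r //.
by move: ltq; rewrite opprB addrC subrK => /ltW.
Qed.

End Certificate.

(** * Weak duality on the categorical product *)

Section ProductBound.
Context {R : realType} {T U : finType} (eG : rel T) (eH : rel U).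
Hypotheses (irrG : irreflexive eG) (irrH : irreflexive eH).
Variables (w : T -> R) (A : T -> T -> R) (a : R).
Variables (w' : U -> R) (B : U -> U -> R) (b : R).
Hypotheses (suppA : forall u v, ~~ eG u v -> A u v = 0)
  (psdA : psd (fun u v => diagonal w u v + A u v))
  (psdaA : psd (fun u v => a * diagonal w u v + (- 1) * A u v))
  (w_gt0 : forall u, 0 < w u).
Hypotheses (suppB : forall u v, ~~ eH u v -> B u v = 0)
  (psdB : psd (fun u v => diagonal w' u v + B u v))
  (psdbB : psd (fun u v => b * diagonal w' u v + (- 1) * B u v))
  (w'_gt0 : forall u, 0 < w' u).

Lemma psd_diagonal_scale (V : finType) (y : V -> R) (C : V -> V -> R) (c m : R) :
  (forall v, 0 < y v) -> c <= m ->
  psd (fun u v => c * diagonal y u v + (- 1) * C u v) ->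
  psd (fun u v => m * diagonal y u v + (- 1) * C u v).
Proof.
move=> y0 cm [symC posC]; split=> [u v|x].
  have := symC u v; rewrite /diagonal [v == u]eq_sym; case: eqP => [->|_] //.
  by rewrite !mulr0 !add0r.
have := posC x; rewrite !bform_addM !bform_scaleM => /le_trans; apply.
rewrite lerD2r ler_wpM2r // bform_diag sumr_ge0 // => v _.
by rewrite mulr_ge0 ?sqr_ge0 ?(ltW (y0 v)).
Qed.

(* With [m = max a b], the kernel [m D D' + A B] is psd because
   [(1 + m) (m D D' + A B) = m (D + A) (D' + B) + (m D - A) (m D' - B)]. *)
Lemma psd_product_kernel (m : R) : 0 < m -> a <= m -> b <= m ->
  psd (fun p q : T * U =>
    m * (diagonal w p.1 q.1 * diagonal w' p.2 q.2) + A p.1 q.1 * B p.2 q.2).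
Proof.
move=> m0 am bm.
have [s1 p1] := psd_tensor R T U _ _ psdA psdB.
have [s2 p2] := psd_tensor R T U _ _ (psd_diagonal_scale T w A a m w_gt0 am psdaA)
  (psd_diagonal_scale U w' B b m w'_gt0 bm psdbB).
have E p q : m * (diagonal w p.1 q.1 * diagonal w' p.2 q.2) + A p.1 q.1 * B p.2 q.2 =
  (1 + m)^-1 * (m * ((diagonal w p.1 q.1 + A p.1 q.1) * (diagonal w' p.2 q.2 + B p.2 q.2)) +
    (m * diagonal w p.1 q.1 + (- 1) * A p.1 q.1) * (m * diagonal w' p.2 q.2 + (- 1) * B p.2 q.2)).
  by field; rewrite gt_eqF // ltr_pwDl // ltW.
split=> [p q|x]; first by rewrite !E s1 s2.
rewrite (bform_eq _ _ _ E) bform_scaleM bform_addM bform_scaleM.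
have m1 : 0 <= (1 + m)^-1 by rewrite invr_ge0 addr_ge0 // ltW.
by rewrite mulr_ge0 // addr_ge0 // mulr_ge0 // ltW.
Qed.

(** The psd kernel is paired with the Gram kernel of [fs], weighted by [z = x (x) y]. The diagonal
    sees only [m D D'], with factor [kappa]; off it only [A B] survives, on product edges, where the
    Gram entries are [- 1]. Nonnegativity of the pairing is the claim. *)
Lemma product_weak_duality (fs : seq (T * U -> R)) (m kappa : R) :
  0 < m -> a <= m -> b <= m ->
  (forall p, \sum_(f <- fs) f p ^+ 2 = kappa) ->
  (forall p q, cat_prod eG eH p q -> \sum_(f <- fs) f p * f q = - 1) ->
  forall x y, bform A x x * bform B y y <=
    m * kappa * (bform (diagonal w) x x * bform (diagonal w') y y).
Proof.
move=> m0 am bm normf edgef x y.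
have [_ posY] := psd_product_kernel m m0 am bm.
set Y := fun p q : T * U => _ in posY.
pose z p := x p.1 * y p.2.
have : 0 <= \sum_(f <- fs) bform Y (fun p => z p * f p) (fun p => z p * f p).
  by rewrite sumr_ge0.
suff -> : \sum_(f <- fs) bform Y (fun p => z p * f p) (fun p => z p * f p) =
    m * kappa * (bform (diagonal w) x x * bform (diagonal w') y y)
     - bform A x x * bform B y y by rewrite subr_ge0.
have tensorE (C : T -> T -> R) (D : U -> U -> R) : bform C x x * bform D y y =
    bform (fun p q : T * U => C p.1 q.1 * D p.2 q.2) z z.
  rewrite /bform sum_pair mulr_suml; apply: eq_bigr => u _.
  rewrite mulr_sumr; apply: eq_bigr => v _.
  rewrite sum_pair mulr_suml; apply: eq_bigr => u' _.
  by rewrite mulr_sumr; apply: eq_bigr => v' _; rewrite /z /=; ring.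
rewrite !tensorE -mulN1r -!bform_scaleM -bform_addM /bform exchange_big.
apply: eq_bigr => p _; rewrite exchange_big; apply: eq_bigr => q _ /=.
rewrite (eq_bigr (fun f : T * U -> R => (Y p q * (z p * z q)) * (f p * f q))); last first.
  by move=> f _; ring.
rewrite -mulr_sumr /Y /diagonal.
have [->|pq] := eqVneq p q.
  rewrite !eqxx suppA ?irrG //.
  rewrite (eq_bigr (fun f => f q ^+ 2)) => [|f _]; last by rewrite expr2.
  by rewrite normf; ring.
have D0 : (if p.1 == q.1 then w p.1 else 0) * (if p.2 == q.2 then w' p.2 else 0) = 0.
  move: pq; rewrite -pair_eqE /pair_eq; case: eqP => _ /=; last by rewrite mul0r.
  by move/negbTE->; rewrite mulr0.
rewrite D0.
have [epq|] := boolP (cat_prod eG eH p q); first by rewrite edgef //; ring.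
rewrite negb_and => /orP[/suppA ->|/suppB ->]; ring.
Qed.

End ProductBound.

(** The suprema [a] and [b] need not be attained, but [max a b * c < a * b] is strict and leaves
    room for [s < a] and [t < b]. For [b <= a], [t] is the midpoint of [c] and [b], and [s] that of
    [a] and the solution [r] of [r * t = a * c]. *)
Lemma mul_max_approx (R : realType) (a b c : R) : 0 < c -> c < a -> c < b ->
  exists s t, [/\ 0 <= s < a, 0 <= t < b & Num.max a b * c < s * t].
Proof.
wlog ab : a b / b <= a => [H|] c0 ca cb.
  case/orP: (le_total b a) => [ab|ba]; first exact: H.
  have [s [t [hs ht st]]] := H b a ba c0 cb ca.
  by exists t, s; rewrite maxC [t * s]mulrC.
rewrite max_l //.
pose t := (b + c) / 2.
have t0 : 0 < t by rewrite /t; lra.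
pose r := a * c / t.
have rt : r * t = a * c by rewrite divfK // gt_eqF.
have r0 : 0 <= r by rewrite divr_ge0 ?mulr_ge0 ?(ltW t0) //; lra.
have ra : r < a.
  by rewrite ltr_pdivrMr // ltr_pM2l /t; lra.
exists ((a + r) / 2), t; split; [lra|by rewrite (ltW t0) /t; lra|].
have := ltr_pM2r t0 r ((a + r) / 2); rewrite rt => ->; lra.
Qed.

(** The hypotheses on [fs] describe a strict vector [k]-colouring scaled by the square root of
    [k - 1]. If [k] were below both values, near-optimal [x] and [y] for the two certificates would
    violate weak duality with [kappa = k - 1]. *)
Lemma thetabar_cat_prod_bound (R : realType) (T U : finType) (eG : rel T) (eH : rel U)
    (k : R) (fs : seq (T * U -> R)) :
  simple_graph eG -> simple_graph eH -> 1 < k ->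
  (forall p, \sum_(f <- fs) f p ^+ 2 = k - 1) ->
  (forall p q, cat_prod eG eH p q -> \sum_(f <- fs) f p * f q = - 1) ->
  thetabar R eG <= k \/ thetabar R eH <= k.
Proof.
move=> gG gH k1 normf edgef.
have [|kG] := leP (thetabar R eG) k; first by left.
have [|kH] := leP (thetabar R eH) k; first by right.
have [w [A [a [[w0 sA pA paA] [ka approxA]]]]] := thetabar_certificate eG gG k k1 kG.
have [w' [B [b [[w'0 sB pB pbB] [kb approxB]]]]] := thetabar_certificate eH gH k k1 kH.
have k0 : 0 < k - 1 by lra.
have [s [t [/andP[s0 sa] /andP[t0 tb] st]]] := mul_max_approx R a b (k - 1) k0 ka kb.
have [x [Wx Ax]] := approxA s sa; have [y [Wy By]] := approxB t tb.
have m0 : 0 < Num.max a b by rewrite lt_max; apply/orP; left; lra.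
have := product_weak_duality eG eH gG.2 w A a w' B b sA pA paA w0 sB pB pbB w'0
  fs (Num.max a b) (k - 1) m0.
rewrite !le_max !lexx orbT => /(_ isT isT normf edgef x y).
have W0 := mulr_gt0 Wx Wy.
have : s * t * (bform (diagonal w) x x * bform (diagonal w') y y) <=
    bform A x x * bform B y y.
  by rewrite mulrACA ler_pM ?mulr_ge0 ?(ltW Wx) ?(ltW Wy).
move: st; rewrite -(ltr_pM2r W0) => h1 h2 h3.
by have := lt_le_trans h1 (le_trans h2 h3); rewrite ltxx.
Qed.

(** * From quantum colourings to Gram vectors *)

Lemma Re_sum (R : rcfType) (I : Type) (r : seq I) (F : I -> R[i]) :
  complex.Re (\sum_(i <- r) F i) = \sum_(i <- r) complex.Re (F i).
Proof. by apply: (big_morph (@complex.Re R)) => // -[a b] [c d]. Qed.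

Lemma Re_mul_conj (R : rcfType) (x y : R[i]) :
  complex.Re (x * y^*) = complex.Re x * complex.Re y + complex.Im x * complex.Im y.
Proof. by case: x => a b; case: y => c d /=; ring. Qed.

Lemma mxtrace_mul_selfadjoint (R : rcfType) (d : nat) (V W : 'M[R[i]]_d) :
  adjmx W = W -> \tr (V *m W) = \sum_i \sum_j V i j * (W i j)^*.
Proof.
move=> adjW; apply: eq_bigr => i _; rewrite mxE; apply: eq_bigr => j _.
by rewrite -{1}adjW !mxE.
Qed.

Section QuantumColoring.
Context {R : rcfType} {T : finType} (e : rel T) (n d : nat).
Variable E : T -> 'I_n -> 'M[R[i]]_d.
Hypotheses (n_gt0 : (0 < n)%N) (d_gt0 : (0 < d)%N).
Hypothesis hom_E : hom_to_meas e (@complete_rel n) E.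

Let V p c := E p c - (n%:R^-1)%:M.

Let adjV p c : adjmx (V p c) = V p c.
Proof.
have [_ adjE] := (hom_E.1 p).1 c.
rewrite /V -{2}adjE; apply/matrixP => i j; rewrite !mxE rmorphB rmorphMn /=.
by rewrite fmorphV rmorph_nat eq_sym.
Qed.

(** Since the projectors sum to the identity, each cross term contributes [- d / n], and the [n]
    constant terms contribute [d / n] together. *)
Let trV p q : \sum_c \tr (V p c *m V q c) =
  \sum_c \tr (E p c *m E q c) - d%:R / n%:R.
Proof.
have sumE u : \sum_c \tr (E u c) = d%:R.
  by rewrite -raddf_sum (hom_E.1 u).2 /= mxtrace1.
have trVc c : \tr (V p c *m V q c) = \tr (E p c *m E q c)
    - n%:R^-1 * \tr (E p c) - n%:R^-1 * \tr (E q c) + n%:R^-2 * d%:R.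
  rewrite /V mulmxBl !mulmxBr mul_scalar_mx mul_mx_scalar -scalar_mxM.
  rewrite !raddfB /= !mxtraceZ mxtrace_scalar.
  by rewrite -[_ / _ *+ d]mulr_natr expr2 invfM; ring.
rewrite (eq_bigr _ (fun c _ => trVc c)) !big_split /= !sumrN -!mulr_sumr !sumE.
rewrite sumr_const card_ord -mulr_natr.
have n0 : n%:R != 0 :> R[i] by rewrite pnatr_eq0 -lt0n.
by field.
Qed.

(** The sum over [c] of [\tr (E p c *m E q c)] is [d] when [p = q] and [0] on edges. Splitting
    entries into real and imaginary parts realises the trace pairing by real vectors. *)
Lemma quantum_coloring_gram : exists fs : seq (T -> R),
  (forall p, \sum_(f <- fs) f p ^+ 2 = n%:R - 1) /\
  (forall p q, e p q -> \sum_(f <- fs) f p * f q = - 1).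
Proof.
(* This scale turns the shift [- d / n] of [trV] into [- 1]. *)
pose s : R := Num.sqrt (n%:R / d%:R).
have n0 : 0 < n%:R :> R by rewrite ltr0n.
have d0 : 0 < d%:R :> R by rewrite ltr0n.
have s2 : s ^+ 2 = n%:R / d%:R by rewrite sqr_sqrtr // divr_ge0 ?ltW.
pose fs := [seq (fun p => s * complex.Re (V p x.1.1 x.1.2 x.2)) | x : 'I_n * 'I_d * 'I_d]
  ++ [seq (fun p => s * complex.Im (V p x.1.1 x.1.2 x.2)) | x : 'I_n * 'I_d * 'I_d].
have fsE p q : \sum_(f <- fs) f p * f q =
    n%:R / d%:R * complex.Re (\sum_c \tr (E p c *m E q c)) - 1.
  have -> : \sum_(f <- fs) f p * f q =
      s ^+ 2 * complex.Re (\sum_c \tr (V p c *m V q c)).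
    rewrite /fs big_cat !big_image /= -big_split /=.
    rewrite Re_sum mulr_sumr sum_pair sum_pair; apply: eq_bigr => c _.
    rewrite mxtrace_mul_selfadjoint // Re_sum mulr_sumr; apply: eq_bigr => i _.
    rewrite Re_sum mulr_sumr; apply: eq_bigr => j _.
    by rewrite Re_mul_conj /=; ring.
  rewrite trV s2.
  have -> : d%:R / n%:R = (d%:R / n%:R : R)%:C%C :> R[i].
    by rewrite rmorphM fmorphV !rmorph_nat.
  case: (\sum_c _) => x y /=; field.
  by rewrite !gt_eqF.
exists fs; split=> [p|p q epq].
  rewrite (eq_bigr (fun f => f p * f p)) => [|f _]; last by rewrite expr2.
  rewrite fsE.
  have -> : \sum_c \tr (E p c *m E p c) = d%:R.
    rewrite -[RHS](mxtrace1 _ d) -(hom_E.1 p).2 raddf_sum; apply: eq_bigr => c _ /=.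
    by have [-> _] := (hom_E.1 p).1 c.
  have -> : complex.Re (d%:R : R[i]) = d%:R by rewrite -(rmorph_nat (real_complex R)).
  by rewrite divfK // gt_eqF.
rewrite fsE big1 ?mulr0 ?sub0r // => c _.
by rewrite (hom_E.2 p q epq) ?mxtrace0 // /complete_rel eqxx.
Qed.

End QuantumColoring.

(** * Bounds on [chi_q] and colourings with at most one colour *)

Lemma chi_q_le (R : rcfType) (T : finType) (e : rel T) (n : nat) :
  quantum_colorable R e n -> (chi_q R e <= n)%N.
Proof.
move=> qn; rewrite /chi_q; case: pselect => // h.
by case: ex_minnP => m _; apply; apply/asboolP.
Qed.

(** Every vertex gets its own colour, encoded by [0] and [1] as projectors in dimension 1. Hence the
    default value in [chi_q] is never reached for loopless graphs. *)
Lemma quantum_colorable_card (R : rcfType) (T : finType) (e : rel T) :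
  irreflexive e -> quantum_colorable R e #|T|.
Proof.
move=> irre; exists 1; split=> //.
exists (fun x c => (c == enum_rank x)%:R%:M); split=> [x|x y exy c c'].
  split=> [c|]; first split.
  - by rewrite -scalar_mxM -natrM mulnb andbb.
  - by apply/matrixP => i j; rewrite !mxE rmorphMn rmorph_nat [j == i]eq_sym.
  - rewrite (bigD1 (enum_rank x)) //= eqxx big1 ?addr0 // => c /negbTE ->.
    by apply/matrixP => i j; rewrite !mxE mul0rn.
rewrite /complete_rel negbK => /eqP <-; rewrite -scalar_mxM -natrM mulnb.
case: eqP => [->|_] /=; last by apply/matrixP => i j; rewrite !mxE mul0rn.
case: eqP => [/enum_rank_inj xy|_] /=; last by apply/matrixP => i j; rewrite !mxE mul0rn.
by rewrite xy irre in exy.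
Qed.

Lemma chi_q_colorable (R : rcfType) (T : finType) (e : rel T) :
  irreflexive e -> quantum_colorable R e (chi_q R e).
Proof.
move=> irre; rewrite /chi_q; case: pselect => [h|[]].
  by case: ex_minnP => m /asboolP.
by exists #|T|; apply/asboolP/quantum_colorable_card.
Qed.

Lemma quantum_colorable_hom (R : rcfType) (T U : finType) (e : rel T) (e' : rel U)
    (h : T -> U) (n : nat) :
  (forall x y, e x y -> e' (h x) (h y)) ->
  quantum_colorable R e' n -> quantum_colorable R e n.
Proof.
move=> homh [d [d0 [f [vf ef]]]]; exists d; split=> //; exists (f \o h).
by split=> [x|x y exy]; [exact: vf | apply/ef/homh].
Qed.

Lemma scalar_mx1_neq0 (R : rcfType) (d : nat) : (0 < d)%N -> (1%:M : 'M[R[i]]_d) <> 0.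
Proof.
move=> d0 /(congr1 (fun M : 'M__ => M (Ordinal d0) (Ordinal d0))).
by rewrite !mxE eqxx; apply/eqP; rewrite oner_eq0.
Qed.

Lemma quantum_colorable0 (R : rcfType) (T : finType) (e : rel T) (x : T) :
  ~ quantum_colorable R e 0.
Proof.
move=> [d [d0 [f [/(_ x)[_ sumf] _]]]]; apply: (scalar_mx1_neq0 R d d0).
by rewrite -sumf big_ord0.
Qed.

Lemma quantum_colorable1 (R : rcfType) (T : finType) (e : rel T) (x y : T) :
  e x y -> ~ quantum_colorable R e 1.
Proof.
move=> exy [d [d0 [f [vf /(_ x y exy ord0 ord0)]]]].
have f1 u : f u ord0 = 1%:M by rewrite -(vf u).2 big_ord1.
by rewrite !f1 mul1mx => /(_ isT); apply: scalar_mx1_neq0.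
Qed.

Lemma quantum_colorable_edgeless (R : rcfType) (T : finType) (e : rel T) :
  (forall x y, ~~ e x y) -> quantum_colorable R e 1.
Proof.
move=> noe; exists 1; split=> //; exists (fun _ _ => 1%:M).
split=> [x|x y exy]; last by have := noe x y; rewrite exy.
split=> [c|]; last by rewrite big_ord1.
split; first by rewrite mul1mx.
by apply/matrixP => i j; rewrite !mxE rmorph_nat eq_sym.
Qed.

Theorem theorem7p3 (R : realType) (T U : finType) (eG : rel T) (eH : rel U) :
  simple_graph eG -> simple_graph eH ->
  (chi_q R eG)%:R = thetabar R eG ->
  (chi_q R eH)%:R = thetabar R eH ->
  chi_q R (cat_prod eG eH) = minn (chi_q R eG) (chi_q R eH).
Proof.
move=> gG gH chiG chiH; have [_ irrG] := gG; have [_ irrH] := gH.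
have irrGH : irreflexive (cat_prod eG eH) by move=> p; rewrite /cat_prod irrG.
apply/eqP; rewrite eqn_leq leq_min; apply/andP; split.
  (* The two projections are homomorphisms, so colourings of either factor pull back to the
     product. *)
  apply/andP; split; apply: chi_q_le.
    apply: (quantum_colorable_hom R _ _ _ eG fst); last exact: chi_q_colorable.
    by move=> x y /andP[].
  apply: (quantum_colorable_hom R _ _ _ eH snd); last exact: chi_q_colorable.
  by move=> x y /andP[].
have := chi_q_colorable R _ _ irrGH; set n := chi_q R (cat_prod eG eH) => qn.
rewrite geq_min.
(* Vector colourings require a parameter above 1, so [n <= 1] is treated separately. *)
have [n1|n1] := ltnP 1 n.
  have [d [d0 [E homE]]] := qn.
  have [fs [normf edgef]] := quantum_coloring_gram _ n d E (ltnW n1) d0 homE.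
  have k1 : 1 < n%:R :> R by rewrite ltr1n.
  have [le|le] := thetabar_cat_prod_bound R T U eG eH n%:R fs gG gH k1 normf edgef.
    by rewrite -(ler_nat R) chiG le.
  by rewrite -[X in _ || X](ler_nat R) chiH le orbT.
(* An empty factor has [chi_q] equal to 0. *)
have [x _|T0] := pickP (fun _ : T => true); last first.
  have := chi_q_le _ _ _ _ (quantum_colorable_card R _ _ irrG).
  by rewrite (eq_card0 T0) leqn0 => /eqP ->.
have [u _|U0] := pickP (fun _ : U => true); last first.
  have := chi_q_le _ _ _ _ (quantum_colorable_card R _ _ irrH).
  by rewrite (eq_card0 U0) leqn0 => /eqP ->; rewrite orbT.
have n0 : n != 0 by apply/eqP => n0; move: qn; rewrite n0; apply: (quantum_colorable0 _ _ _ (x, u)).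
have {n1 n0} n1 : n = 1 by case: n n0 n1 {qn} => [|[]].
rewrite n1 in qn *.
(* One colour forces the product to be edgeless. An edge in each factor would give a product edge,
   so some factor is edgeless and has [chi_q] at most 1. *)
have [/existsP[x' /existsP[y' exy]]|/existsPn noG] := boolP [exists x, exists y, eG x y].
  apply/orP; right; apply/chi_q_le/quantum_colorable_edgeless => u' v'.
  apply/negP => euv; apply: (quantum_colorable1 _ _ _ (x', u') (y', v') _ qn).
  by rewrite /cat_prod exy.
apply/orP; left; apply/chi_q_le/quantum_colorable_edgeless => x' y'.
by have /existsPn := noG x'.
Qed.
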